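(* There exist a poset $P$ and a tame $P$-module $M$ whose Int-GRI $\mathrm{rk}_M^{\mathrm{Int}}$ is not Möbius invertible.
   Context: Fix a field $k$; $\mathbf{vec}$ is the category of finite-dimensional $k$-vector spaces. A poset $P$ is regarded as a category (a unique morphism $p\to q$ iff $p\le q$). A $P$-module is a functor $M:P\to\mathbf{vec}$, with $M_p:=M(p)$ and $\varphi_M(p,q):=M(p\le q)$. Tameness: an encoding of a $P$-module $M$ by a poset $Q$ is an order-preserving map $\pi:P\to Q$ together with a $Q$-module $N$ such that $M=\pi^*N$, i.e. $M_p=N_{\pi(p)}$ and $\varphi_M(p,p')=\varphi_N(\pi(p),\pi(p'))$ for all $p\le p'$. The encoding is finite if $Q$ is finite. $M$ is tame if it admits a finite encoding. An interval of $P$ is a nonempty $I\subset P$ that is convex ($p,r\in I$, $p\le q\le r$ imply $q\in I$) and connected (any two elements of $I$ are joined by a finite sequence in $I$ whose consecutive elements are comparable). $\mathrm{Int}(P)$ is the set of intervals of $P$. For a connected poset $P$ and a $P$-module $M$, $\mathrm{rk}(M)$ is the rank of the canonical map $\varprojlim M\to\varinjlim M$, namely $i_p\circ\pi_p$ for any $p\in P$ ($\pi_p:\varprojlim M\to M_p$, $i_p:M_p\to\varinjlim M$ the structure maps). The Int-GRI of $M$ is $\mathrm{rk}_M^{\mathrm{Int}}:\mathrm{Int}(P)\to\mathbb Z_{\ge0}$, $I\mapsto \mathrm{rk}(M|_I)$. $\mathrm{rk}_M^{\mathrm{Int}}$ is Möbius invertible if there exist $\mathcal I\subset\mathrm{Int}(P)$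 and a map $d:\mathcal I\to\mathbb Z$ such that for every $I\in\mathrm{Int}(P)$, $\mathrm{rk}_M^{\mathrm{Int}}(I)=\sum_{J\supset I,\,J\in\mathcal I} d(J)$, where the sum has only finitely many nonzero summands. *)

(* Defs.v *)
From HB Require Import structures.
From mathcomp Require Import all_boot all_order all_algebra finmap.
From mathcomp Require Import all_classical.

Set Implicit Arguments.
Unset Strict Implicit.
Unset Printing Implicit Defensive.

Import Order.TTheory GRing.Theory.

Local Open Scope classical_set_scope.
Local Open Scope order_scope.
Local Open Scope ring_scope.
Local Open Scope quotient_scope.

Section Linear.
Variable k : fieldType.
Implicit Types U V : lmodType k.

(* W has a basis of n elements *)
Definition has_dim V (W : set V) (n : nat) : Prop :=
  exists e : 'I_n -> V,
    [/\ forall i, W (e i),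
        forall c : 'I_n -> k, \sum_i c i *: e i = 0 -> forall i, c i = 0
      & forall w, W w -> exists c : 'I_n -> k, w = \sum_i c i *: e i].

Lemma has_dim_uniq V (W : set V) m n : has_dim W m -> has_dim W n -> m = n.
Proof.
suff le_dim a b : has_dim W a -> has_dim W b -> (a <= b)%N.
  by move=> hm hn; apply/eqP; rewrite eqn_leq !le_dim.
move=> [e [We fe _]] [f [_ _ gf]].
have /choice[A eA] i : exists c, e i = \sum_j c j *: f j by exact: gf.
pose B := \matrix_(i, j) A i j.
suff: row_free B by rewrite /row_free => /eqP <-; exact: rank_leq_col.
apply/row_freeP; apply/row_freeP/inj_row_free => v vB.
apply/rowP => i; rewrite mxE; apply: (fe (v ord0)) => {i}.
under eq_bigr do rewrite eA scaler_sumr.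
rewrite exchange_big big1 //= => j _; under eq_bigr do rewrite scalerA.
rewrite -scaler_suml; have /rowP/(_ j) := vB; rewrite !mxE.
by under eq_bigr do rewrite mxE; move=> ->; rewrite scale0r.
Qed.

(* The value is 0 when the image is not finite dimensional. *)
Definition rank U V (f : {linear U -> V}) : nat :=
  xget 0%N [set n | has_dim (range f) n].

Lemma rankE U V (f : {linear U -> V}) n : has_dim (range f) n -> rank f = n.
Proof. by move=> hn; apply: has_dim_uniq (hn); exact: (xgetI _ hn). Qed.

Lemma eq_rank U V (f g : {linear U -> V}) : f =1 g -> rank f = rank g.
Proof. by move=> /funext fg; rewrite /rank fg. Qed.

Definition submodule V (W : set V) : Prop :=
  W 0 /\ forall (a : k) u v, W u -> W v -> W (a *: u + v).

Definition lspan V (S : set V) : set V := smallest (@submodule V) S.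

End Linear.

(* The library only has products and direct sums over a finite index type. *)
Section Product.
Variables (k : fieldType) (I : choiceType) (V : I -> lmodType k).

Definition prodM : Type := forall i, V i.

HB.instance Definition _ := Choice.on prodM.

Let add (s t : prodM) : prodM := fun i => s i + t i.
Let opp (s : prodM) : prodM := fun i => - s i.
Let zero : prodM := fun i => 0.
Let scale (a : k) (s : prodM) : prodM := fun i => a *: s i.

Let addA : associative add.
Proof. by move=> s t u; apply: functional_extensionality_dep => i; exact: addrA. Qed.
Let addC : commutative add.
Proof. by move=> s t; apply: functional_extensionality_dep => i; exact: addrC. Qed.
Let add0 : left_id zero add.
Proof. by move=> s; apply: functional_extensionality_dep => i; exact: add0r. Qed.
Let addN : left_inverse zero opp add.
Proof. by move=> s; apply: functional_extensionality_dep => i; exact: addNr. Qed.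

HB.instance Definition _ := GRing.isZmodule.Build prodM addA addC add0 addN.

Let scaleA a b s : scale a (scale b s) = scale (a * b) s.
Proof. by apply: functional_extensionality_dep => i; exact: scalerA. Qed.
Let scale1 : left_id 1 scale.
Proof. by move=> s; apply: functional_extensionality_dep => i; exact: scale1r. Qed.
Let scaleDr : right_distributive scale +%R.
Proof. by move=> a s t; apply: functional_extensionality_dep => i; exact: scalerDr. Qed.
Let scaleDl s : {morph scale^~ s : a b / a + b}.
Proof. by move=> a b; apply: functional_extensionality_dep => i; exact: scalerDl. Qed.

HB.instance Definition _ :=
  GRing.Zmodule_isLmodule.Build k prodM scaleA scale1 scaleDr scaleDl.

Definition finsupp : {pred prodM} :=
  fun s => `[< finite_set [set i | s i != 0] >].

Fact finsupp_submod_closed : GRing.submod_closed finsupp.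
Proof.
split; first by apply/asboolP; rewrite (_ : [set _ | _] = set0) // -subset0 => i /eqP.
move=> a s t /asboolP fs /asboolP ft; apply/asboolP.
apply: (@sub_finite_set _ _ ([set i | s i != 0] `|` [set i | t i != 0])).
  move=> i /=; apply: contra_neqP => /not_orP[/negP/negPn/eqP si /negP/negPn/eqP ti].
  by have -> : (a *: s + t) i = a *: s i + t i by []; rewrite si ti scaler0 addr0.
by rewrite finite_setU.
Qed.
HB.instance Definition _ :=
  GRing.isSubmodClosed.Build k prodM finsupp finsupp_submod_closed.

Record dsum : Type := DSum { dsum_val :> prodM; _ : dsum_val \in finsupp }.
HB.instance Definition _ := [isSub for dsum_val].
HB.instance Definition _ := [Choice of dsum by <:].
HB.instance Definition _ := [SubChoice_isSubLmodule of dsum by <:].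

Let single i (v : V i) : prodM := eqtype.dfwith (T := V) (fun j => 0) v.

Fact single_finsupp i (v : V i) : single v \in finsupp.
Proof.
apply/asboolP; apply: (@sub_finite_set _ _ [set i]) => // j /=.
by rewrite /single; case: eqtype.dfwithP => //= j' _ /eqP.
Qed.

Definition dsum_in i (v : V i) : dsum := DSum (single_finsupp v).

Fact dsum_in_linear i : linear (@dsum_in i).
Proof.
move=> a u v; apply: val_inj; apply: functional_extensionality_dep => j /=.
rewrite -[RHS]/(a *: single u j + single v j) /single.
have [<-|ij] := eqVneq i j; first by rewrite !eqtype.dfwith_in.
by rewrite !eqtype.dfwith_out// scaler0 addr0.
Qed.
HB.instance Definition _ i :=
  GRing.isLinear.Build k (V i) dsum *:%R (@dsum_in i) (@dsum_in_linear i).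

Lemma dsum_ext (C : lmodType k) (g h : {linear dsum -> C}) :
  (forall i (v : V i), g (dsum_in v) = h (dsum_in v)) -> g =1 h.
Proof.
move=> gh s; have /asboolP/finite_seqP[X sX] := valP s.
have {sX} : forall i, val s i != 0 -> i \in X.
  by move=> i si; have : [set` X] i by rewrite -sX.
elim: X s => [|i X IH] s sX.
  suff -> : s = 0 by rewrite !linear0.
  apply: val_inj; apply: functional_extensionality_dep => i.
  by apply/eqP; apply: contraT => /sX.
rewrite -[s](subrK (dsum_in (val s i))).
rewrite [LHS]linearD [RHS]linearD gh; congr (_ + _); apply: IH => j.
rewrite (_ : val _ j = val s j - single (val s i) j)// /single.
have [<-|ij] := eqVneq i j; first by rewrite eqtype.dfwith_in subrr eqxx.
rewrite eqtype.dfwith_out// subr0 => /sX; rewrite inE eq_sym.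
by rewrite (negPf ij).
Qed.

Lemma dsum_desc (C : lmodType k) (f : forall i, {linear V i -> C}) :
  exists g : {linear dsum -> C}, forall i v, g (dsum_in v) = f i v.
Proof.
pose g (s : dsum) : C := \sum_(i \in [set: I]) f i (val s i).
have gE (s : dsum) A : finite_set A -> [set i | val s i != 0] `<=` A ->
    g s = \sum_(i <- fset_set A) f i (val s i).
  move=> fA sA; rewrite -fsbig_finite//; apply/esym/fsbig_widen => //.
  move=> i [_ Ai]; suff si : val s i = 0 by rewrite /preimage /mkset si linear0.
  by apply/eqP; apply: contra_notT Ai => /sA.
have g_lin : linear g.
  move=> a s t; pose A := [set i | val s i != 0] `|` [set i | val t i != 0].
  have fA : finite_set A.
    by have [/asboolP ? /asboolP ?] := (valP s, valP t); rewrite finite_setU.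
  rewrite !(gE _ A)//; [|by move=> i ?; right|by move=> i ?; left|].
    rewrite scaler_sumr -big_split; apply: eq_bigr => i _.
    by rewrite (_ : val _ i = a *: val s i + val t i)// linearP.
  move=> i; rewrite /mkset (_ : val _ i = a *: val s i + val t i)//.
  have [->|] := eqVneq (val s i) 0; last by left.
  by rewrite scaler0 add0r; right.
exists (HB.pack_for {linear dsum -> C} g
  (GRing.isLinear.Build _ _ _ _ g g_lin)) => i v /=.
rewrite (gE _ [set i]) ?fset_set1 ?big_seq_fset1 /=.
- by rewrite /single eqtype.dfwith_in.
- exact: finite_set1.
- by move=> j /=; rewrite /single; case: eqtype.dfwithP => //= j' _ /eqP.
Qed.

End Product.

Section QuotientModule.
Variables (k : fieldType) (V : lmodType k) (S : set V).

Definition lspan_pred : {pred V} := fun x => x \in lspan S.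

Fact lspan_submod_closed : GRing.submod_closed lspan_pred.
Proof.
split; first by apply/mem_set => W [[W0 _] _].
move=> a u v; rewrite !unfold_in => /set_mem uS /set_mem vS.
by apply/mem_set => W SW; apply: SW.1.2; [exact: uS|exact: vS].
Qed.
HB.instance Definition _ :=
  GRing.isSubmodClosed.Build k V lspan_pred lspan_submod_closed.

(* The quotient of V by the submodule generated by S. *)
Definition quotM : Type := {ideal_quot lspan_pred}.
HB.instance Definition _ := GRing.Zmodule.on quotM.

Definition quot_proj (v : V) : quotM := \pi_({ideal_quot lspan_pred}) v.

Lemma quot_projP u v : quot_proj u = quot_proj v <-> lspan S (u - v).
Proof.
split=> [/eqP|h]; last apply/eqP; rewrite -Quotient.idealrBE /in_mem/=.
  by move=> /set_mem.
exact/mem_set.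
Qed.

Lemma quot_reprK (x : quotM) : quot_proj (repr (x : {ideal_quot lspan_pred})) = x.
Proof. exact: reprK. Qed.

Lemma quot_projD : {morph quot_proj : u v / u + v}.
Proof. exact: Quotient.pi_add. Qed.

Let scale (a : k) (x : quotM) : quotM :=
  quot_proj (a *: repr (x : {ideal_quot lspan_pred})).

Let scale_proj a v : scale a (quot_proj v) = quot_proj (a *: v).
Proof.
apply/quot_projP; rewrite -scalerBr.
have /quot_projP : quot_proj (repr (quot_proj v : {ideal_quot lspan_pred})) = quot_proj v.
  exact: quot_reprK.
move=> h W SW; case: (SW) => -[W0 WD] _; rewrite -[X in W X]addr0.
by apply: WD => //; exact: h.
Qed.

Let scaleA a b x : scale a (scale b x) = scale (a * b) x.
Proof. by rewrite -[x]quot_reprK !scale_proj scalerA. Qed.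
Let scale1 : left_id 1 scale.
Proof. by move=> x; rewrite -[x]quot_reprK scale_proj scale1r. Qed.
Let scaleDr : right_distributive scale +%R.
Proof.
move=> a x y; rewrite -[x]quot_reprK -[y]quot_reprK.
by rewrite -quot_projD !scale_proj scalerDr quot_projD.
Qed.
Let scaleDl x : {morph scale^~ x : a b / a + b}.
Proof.
by move=> a b; rewrite -[x]quot_reprK !scale_proj scalerDl quot_projD.
Qed.

HB.instance Definition _ :=
  GRing.Zmodule_isLmodule.Build k quotM scaleA scale1 scaleDr scaleDl.

Fact quot_proj_linear : linear quot_proj.
Proof. by move=> a u v; rewrite quot_projD -scale_proj. Qed.
HB.instance Definition _ :=
  GRing.isLinear.Build k V quotM *:%R quot_proj quot_proj_linear.

End QuotientModule.

Section Subposet.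
Variables (disp : Order.disp_t) (P : porderType disp) (I : set P).

Definition subposet : Type := {x : P | x \in I}.
HB.instance Definition _ := SubChoice.on subposet.
HB.instance Definition _ := [SubChoice_isSubPOrder of subposet by <: with disp].

End Subposet.

Section PModule.
Variable k : fieldType.

Record pmodule (disp : Order.disp_t) (P : porderType disp) := PModule {
  pmod_obj :> P -> vectType k;
  pmod_map : forall p q, (p <= q)%O -> 'Hom(pmod_obj p, pmod_obj q);
  pmod_map_id : forall p (pp : (p <= p)%O), pmod_map pp = \1%VF;
  pmod_map_comp : forall p q r (pq : (p <= q)%O) (qr : (q <= r)%O) (pr : (p <= r)%O),
    pmod_map pr = (pmod_map qr \o pmod_map pq)%VF
}.

Program Definition pullback disp disp' (P : porderType disp) (Q : porderType disp')
    (f : P -> Q) (mf : {homo f : p q / (p <= q)%O}) (N : pmodule Q) : pmodule P :=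
  @PModule _ P (fun p => N (f p)) (fun p q pq => pmod_map N (mf p q pq)) _ _.
Next Obligation. by move=> *; exact: pmod_map_id. Qed.
Next Obligation. by move=> *; exact: pmod_map_comp. Qed.

(* The encoding is a strict equality of functors, not just an isomorphism. *)
Definition tame disp (P : porderType disp) (M : pmodule P) : Prop :=
  exists (disp' : Order.disp_t) (Q : finPOrderType disp') (f : P -> Q)
         (mf : {homo f : p q / (p <= q)%O}) (N : pmodule Q),
    M = pullback mf N.

Section Limits.
Variables (disp : Order.disp_t) (P : porderType disp) (M : pmodule P).

(* Limits and colimits over an infinite poset can be infinite dimensional, so
   they are formed among all k-modules; Mlmod forgets finite dimension. *)
Let Mlmod (p : P) : lmodType k := M p.

Definition compatible : {pred prodM Mlmod} :=
  fun s => `[< forall p q (pq : (p <= q)%O), pmod_map M pq (s p) = s q >].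

Fact compatible_submod_closed : GRing.submod_closed compatible.
Proof.
split; first by apply/asboolP => p q pq; exact: linear0.
move=> a s t /asboolP cs /asboolP ct; apply/asboolP => p q pq.
rewrite -[LHS]/(pmod_map M pq (a *: s p + t p)) linearP.
exact: (f_equal2 (fun x y => a *: x + y) (cs p q pq) (ct p q pq)).
Qed.
HB.instance Definition _ :=
  GRing.isSubmodClosed.Build k (prodM Mlmod) compatible compatible_submod_closed.

Record limit : Type := Limit { limit_val :> prodM Mlmod; _ : limit_val \in compatible }.
HB.instance Definition _ := [isSub for limit_val].
HB.instance Definition _ := [Choice of limit by <:].
HB.instance Definition _ := [SubChoice_isSubLmodule of limit by <:].

Definition limit_proj (p : P) (s : limit) : M p := limit_val s p.

Fact limit_proj_linear p : linear (limit_proj p).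
Proof. by []. Qed.
HB.instance Definition _ p :=
  GRing.isLinear.Build k limit (M p) *:%R (limit_proj p) (limit_proj_linear p).

Definition colimit_rel : set (dsum Mlmod) :=
  [set x | exists p q (pq : (p <= q)%O) (v : M p),
     x = dsum_in (V := Mlmod) (pmod_map M pq v) - dsum_in (V := Mlmod) v].

Definition colimit : Type := quotM colimit_rel.
HB.instance Definition _ := GRing.Lmodule.on colimit.

Definition colimit_in (p : P) (v : M p) : colimit :=
  quot_proj colimit_rel (dsum_in (V := Mlmod) v).

Fact colimit_in_linear p : linear (@colimit_in p).
Proof. by move=> a u v; rewrite /colimit_in !linearP. Qed.
HB.instance Definition _ p :=
  GRing.isLinear.Build k (M p) colimit *:%R (@colimit_in p) (@colimit_in_linear p).

Lemma limit_projE p q (pq : (p <= q)%O) s :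
  pmod_map M pq (limit_proj p s) = limit_proj q s.
Proof. by case: s => s /= sc; move/asboolP: (sc) => cs; exact: cs. Qed.

Lemma limit_ext s t : (forall p, limit_proj p s = limit_proj p t) -> s = t.
Proof. by move=> st; apply: val_inj; apply: functional_extensionality_dep. Qed.

(* Universal properties of limit and colimit: limit_lift with limit_ext, and
   colimit_desc with colimit_ext. *)
Lemma limit_lift (L : lmodType k) (f : forall p, {linear L -> M p}) :
    (forall p q (pq : (p <= q)%O) x, pmod_map M pq (f p x) = f q x) ->
  exists g : {linear L -> limit}, forall p x, limit_proj p (g x) = f p x.
Proof.
move=> fE; have fc x : ((fun p => f p x) : prodM Mlmod) \in compatible.
  by apply/asboolP => p q pq; exact: fE.
pose g x : limit := Limit (fc x).
have g_lin : linear g.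
  by move=> a x y; apply: limit_ext => p; rewrite linearP; exact: linearP.
by exists (HB.pack_for {linear L -> limit} g
  (GRing.isLinear.Build _ _ _ _ g g_lin)).
Qed.

Lemma colimit_inE p q (pq : (p <= q)%O) v :
  colimit_in (pmod_map M pq v) = colimit_in v.
Proof.
by apply/quot_projP => W [_]; apply; exists p, q, pq, v.
Qed.

Lemma colimit_desc (C : lmodType k) (f : forall p, {linear M p -> C}) :
    (forall p q (pq : (p <= q)%O) v, f q (pmod_map M pq v) = f p v) ->
  exists g : {linear colimit -> C}, forall p v, g (colimit_in v) = f p v.
Proof.
move=> fE; have [g gE] := @dsum_desc _ _ Mlmod C f.
have g0 s : lspan colimit_rel s -> g s = 0.
  move=> /(_ [set t | g t = 0]); apply; split.
    by split=> [|a u v gu gv] /=; rewrite ?linear0 // linearP gu gv scaler0 addr0.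
  by move=> _ [p [q [pq [v ->]]]] /=; rewrite linearB !gE fE subrr.
have gP s t : quot_proj colimit_rel s = quot_proj colimit_rel t -> g s = g t.
  by move=> /quot_projP /g0 /eqP; rewrite linearB subr_eq0 => /eqP.
pose h (x : colimit) : C := g (repr (x : {ideal_quot lspan_pred colimit_rel})).
have hE s : h (quot_proj colimit_rel s) = g s.
  by apply: gP; exact: quot_reprK.
have h_lin : linear h.
  move=> a x y; rewrite -[x in LHS]quot_reprK -[y in LHS]quot_reprK.
  by rewrite -linearP hE linearP.
exists (HB.pack_for {linear colimit -> C} h
  (GRing.isLinear.Build _ _ _ _ h h_lin)) => p v /=.
by rewrite hE gE.
Qed.

Lemma colimit_ext (C : lmodType k) (g h : {linear colimit -> C}) :
  (forall p (v : M p), g (colimit_in v) = h (colimit_in v)) -> g =1 h.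
Proof.
move=> gh x; rewrite -[x]quot_reprK.
exact: (@dsum_ext _ _ Mlmod C (g \o quot_proj colimit_rel) (h \o quot_proj colimit_rel)).
Qed.

Definition canonical_map (p : P) : {linear limit -> colimit} :=
  @colimit_in p \o limit_proj p.

(* For a connected poset this does not depend on p, see int_gri_base. *)
Definition grank (p : P) : nat := rank (canonical_map p).

Lemma canonical_map_le p q : (p <= q)%O -> canonical_map p =1 canonical_map q.
Proof.
by move=> pq s; rewrite /canonical_map/= -(colimit_inE pq) limit_projE.
Qed.

End Limits.

End PModule.

Section Interval.
Variables (disp : Order.disp_t) (P : porderType disp).

Definition convex (I : set P) : Prop :=
  forall p q r, I p -> I r -> (p <= q)%O -> (q <= r)%O -> I q.

Definition connected (I : set P) : Prop :=
  forall p q, I p -> I q ->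
    exists s : seq P,
      [/\ path (fun x y => (x >=< y)%O) p s, last p s = q & {in s, forall x, I x}].

Definition Int : set (set P) := [set I | [/\ I !=set0, convex I & connected I]].

Fact Int_neq0 (I : Int) : exists p : P, p \in val I.
Proof. by case: I => I /= /set_mem[[p Ip] _ _]; exists p; exact/mem_set. Qed.

(* An arbitrary point of I *)
Definition Int_base (I : Int) : subposet (val I) :=
  let: exist p pI := cid (Int_neq0 I) in Sub p pI.

Definition mobius_invertible (r : Int -> nat) : Prop :=
  (* \sum_(J \in A) is 0 by convention when infinitely many terms are nonzero,
     hence the separate finiteness clause. *)
  exists (F : set Int) (d : F -> int), forall I : Int,
    let above : set F := [set J : F | val I `<=` val (val J)] in
    finite_set (above `&` [set J | d J != 0]) /\
    (r I)%:Z = \sum_(J \in above) d J.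

End Interval.

Arguments Int {disp} P.

Section IntGRI.
Variables (k : fieldType) (disp : Order.disp_t) (P : porderType disp).
Variable M : pmodule k P.

Fact val_homo (I : set P) :
  {homo (val : subposet I -> P) : p q / (p <= q)%O}.
Proof. by []. Qed.

Definition restr (I : set P) : pmodule k (subposet I) :=
  pullback (@val_homo I) M.

Definition int_gri (I : Int P) : nat := grank (restr (val I)) (Int_base I).

Lemma int_gri_base (I : Int P) (p : subposet (val I)) :
  int_gri I = grank (restr (val I)) p.
Proof.
have [_ _ cI] := set_mem (valP I).
have zigzag s : forall q : subposet (val I),
    path (fun x y => (x >=< y)%O) (val q) s -> last (val q) s = val p ->
    {in s, forall x, val I x} ->
  canonical_map (restr (val I)) q =1 canonical_map (restr (val I)) p.
  elim: s => [|x s IH] q /=; first by move=> _ /val_inj ->.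
  move=> /andP[qx xs] sp sI.
  have xI : x \in val I by apply/mem_set/sI; rewrite inE eqxx.
  pose x' : subposet (val I) := Sub x xI.
  have /(_ xs sp)IHx := IH x'.
  move=> t; rewrite -IHx; last by move=> y ys; apply: sI; rewrite inE ys orbT.
  by case/orP: qx => qx; [|apply/esym]; exact: canonical_map_le.
have [s [qs sp sI]] := cI _ _ (set_mem (valP (Int_base I))) (set_mem (valP p)).
by apply: eq_rank; exact: zigzag sp sI.
Qed.

End IntGRI.

(* Main.v *)
Require Import Defs.
From mathcomp Require Import all_boot all_order all_algebra all_classical.
From HB Require Import structures.

(* The poset has minimal elements b, x_0, x_1, ... and maximal elements c, y_0,
   y_1, ..., with b below every maximal element, c above every minimal one, and
   x_n < y_n. The module is k everywhere, with all maps the identity except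
   x_n -> y_n, which is zero; it is pulled back from the four-element poset
   {b, x, c, y}. The rank of an interval containing both x_n and y_n for some n
   is 0, and otherwise it is 1. So the interval containing b, c and exactly one
   of x_m, y_m for each m has rank 1 while all larger ones have rank 0, which
   forces a nonzero coefficient in any Moebius inversion. There are infinitely
   many such intervals above {b, c}, contradicting finiteness. *)

Set Implicit Arguments.
Unset Strict Implicit.
Unset Printing Implicit Defensive.

Import Order.TTheory GRing.Theory.

(** A maximal [m] of the tail stays maximal unless [R m x]; in that case [x] replaces it, since
    [R x y] yields [R m y], hence [R y m] and [R y x]. *)
Lemma seq_maximal (T : eqType) (R : T -> T -> Prop) (s : seq T) :
    (forall x y z, R x y -> R y z -> R x z) -> s != [::] ->
  exists2 x, x \in s & forall y, y \in s -> R x y -> R y x.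
Proof.
move=> Rtr; elim: s => [//|x s IH] _; have [->|/IH[m ms mmax]] := eqVneq s [::].
  by exists x; rewrite ?mem_head // => y; rewrite inE => /eqP ->.
have [Rmx|nRmx] := pselect (R m x); last first.
  by exists m; rewrite ?inE ?ms ?orbT // => y; rewrite inE => /predU1P[->|/mmax].
exists x; first exact: mem_head.
move=> y; rewrite inE => /predU1P[->|/mmax ymax Rxy] //.
exact: Rtr (ymax (Rtr _ _ _ Rmx Rxy)) Rmx.
Qed.

Section MobiusInversion.
Local Open Scope classical_set_scope.
Local Open Scope ring_scope.
Variables (disp : Order.disp_t) (P : porderType disp).

(* If K is maximal in the support of d above J, then r K = d K != 0, so K = J. *)
Lemma mobius_coef_neq0 (r : Int P -> nat) (F : set (Int P)) (d : F -> int)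
    (J : Int P) :
    (forall I : Int P,
      let above : set F := [set K : F | val I `<=` val (val K)] in
      finite_set (above `&` [set K | d K != 0]) /\
      (r I)%:Z = \sum_(K \in above) d K) ->
    r J != 0%N ->
    (forall K : Int P, val J `<=` val K -> r K != 0%N -> K = J) ->
  exists2 K : F, val K = J & d K != 0.
Proof.
move=> inv rJ Jmax; have [/finite_seqP[s sE] rE] := inv J.
have /(@seq_maximal _ (fun K L : F => val (val K) `<=` val (val L)))[] : s != [::].
- apply: contraNneq rJ => s0; rewrite -eqz_nat rE fsbig1 // => K JK.
  apply/eqP/negPn/negP => dK.
  suff : [set` s] K by rewrite s0.
  by rewrite -sE.
- by move=> x y z; exact: subset_trans.
move=> K Ks Kmax; have : [set` s] K by [].
rewrite -sE => -[JK dK]; exists K => //; apply: Jmax => //.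
have [_ rK] := inv (val K).
rewrite -eqz_nat rK -(fsbig_widen [set K]) ?fsbig_set1 // => [L ->//|L [KL nLK]].
apply/eqP/negPn/negP => dL; apply: nLK.
have Ls : L \in s.
  suff : [set` s] L by [].
  by rewrite -sE; split => //; exact: subset_trans KL.
by apply/val_inj/val_inj/seteqP; split => //; exact: Kmax.
Qed.

(** Every [J n] carries a nonzero coefficient and contains [I], so the sum at [I] has infinitely
    many nonzero terms. *)
Lemma mobius_not_invertible (r : Int P -> nat) (I : Int P) (J : nat -> Int P) :
    injective J -> (forall n, val I `<=` val (J n)) ->
    (forall n, r (J n) != 0%N) ->
    (forall n (K : Int P), val (J n) `<=` val K -> r K != 0%N -> K = J n) ->
  ~ mobius_invertible r.
Proof.
move=> J_inj IJ rJ Jmax [F [d inv]].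
have [/(finite_image val)/(finite_preimage (in2W J_inj)) fin _] := inv I.
apply: infinite_nat; apply: sub_finite_set fin => n _.
have [K KJ dK] := mobius_coef_neq0 inv (rJ n) (Jmax n).
by exists K => //; split => //=; rewrite KJ; exact: IJ.
Qed.

End MobiusInversion.

Section Rank.
Local Open Scope ring_scope.
Variable k : fieldType.

Lemma rank_eq0 (U V : lmodType k) (f : {linear U -> V}) :
  f =1 (fun=> 0) -> rank f = 0%N.
Proof.
move=> f0; apply: rankE; exists (fun=> 0); split => [[]//|c _ []//|w [u _ <-]].
by exists (fun=> 0); rewrite big_ord0 f0.
Qed.

Lemma rank_eq1 (U V : lmodType k) (f : {linear U -> V}) u :
  f u != 0 -> (forall v, exists c : k, f v = c *: f u) -> rank f = 1%N.
Proof.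
move=> fu0 fu; apply: rankE; exists (fun=> f u).
split=> [_|c|_ [v _ <-]]; first by exists u.
  rewrite big_ord1 => /eqP; rewrite scaler_eq0 (negPf fu0) orbF => /eqP c0 i.
  by rewrite (ord1 i).
by have [c ->] := fu v; exists (fun=> c); rewrite big_ord1.
Qed.

Variables (disp : Order.disp_t) (P : porderType disp) (M : pmodule k P).

(** The component at [q] of a point of the limit is the image of its component at [p], hence
    zero. *)
Lemma grank_eq0 p q (pq : (p <= q)%O) : pmod_map M pq = 0 -> grank M q = 0%N.
Proof.
move=> M0; apply: rank_eq0 => s /=.
by rewrite -(limit_projE pq) M0 lfunE /= linear0.
Qed.

(** The universal properties turn [phi] and [psi] into maps from [k] to the limit and from the
    colimit to [k]. The composite through the canonical map is the identity of [k], so the rank is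
    positive; it is at most 1 because the canonical map factors through [M p]. *)
Lemma grank_const (phi : forall p, {linear k^o -> M p})
    (psi : forall p, {linear M p -> k^o}) p :
    (forall p, cancel (phi p) (psi p)) -> (forall p, cancel (psi p) (phi p)) ->
    (forall p q (pq : (p <= q)%O) x, pmod_map M pq (phi p x) = phi q x) ->
  grank M p = 1%N.
Proof.
move=> phiK psiK phiE; have [g gE] := limit_lift phiE.
have [|h hE] := colimit_desc (f := psi).
  by move=> x y xy v; rewrite -[in LHS](psiK x v) phiE phiK.
apply: (@rank_eq1 _ _ _ (g 1)) => [|s].
  by apply/eqP => /(congr1 h)/eqP; rewrite /= hE gE phiK linear0 oner_eq0.
exists (psi p (limit_proj p s)).
rewrite -linearZ -linearZ /= gE.
by rewrite -[in LHS](psiK p (limit_proj _ _)) -[in LHS](mulr1 (psi p _)).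
Qed.

End Rank.

(* (false, None), (true, None), (false, Some n), (true, Some n) stand for b, c,
   x_n, y_n. *)
Definition spider (T : Type) : Type := (bool * option T)%type.

HB.instance Definition _ (T : choiceType) := Choice.on (spider T).

Definition spider_le (T : eqType) : rel (spider T) := fun p q =>
  (p == q) || [&& ~~ p.1, q.1 & [|| p.2 == None, q.2 == None | p.2 == q.2]].

Fact spider_le_refl (T : eqType) : reflexive (@spider_le T).
Proof. by move=> p; rewrite /spider_le eqxx. Qed.

Fact spider_le_anti (T : eqType) : antisymmetric (@spider_le T).
Proof.
move=> p q /andP[/predU1P[//|/and3P[_ q1 _]] /predU1P[//|/and3P[+ _ _]]].
by rewrite q1.
Qed.

(** Strict relations go from [false] to [true], so two of them never compose. Functoriality of
    [spider_hom] and convexity in [core_Int] rest on the same fact. *)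
Fact spider_le_trans (T : eqType) : transitive (@spider_le T).
Proof.
move=> q p r /predU1P[-> //|pq] /predU1P[<-|/and3P[+ _ _]].
  by rewrite /spider_le pq orbT.
by case/and3P: pq => _ ->.
Qed.

HB.instance Definition _ (T : choiceType) :=
  Order.Le_isPOrder.Build Order.default_display (spider T)
    (@spider_le_refl T) (@spider_le_anti T) (@spider_le_trans T).
HB.instance Definition _ (T : finType) := Finite.on (spider T).

Definition spider_map (T T' : Type) (f : T -> T') (p : spider T) : spider T' :=
  (p.1, omap f p.2).

Lemma spider_map_homo (T T' : choiceType) (f : T -> T') :
  {homo spider_map f : p q / (p <= q)%O}.
Proof.
move=> [a u] [b v] /predU1P[-> //|/and3P[/= a0 b1 uv]].
apply/orP; right; rewrite /= a0 b1 /=.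
by case: u v uv => [x|] [y|] //= /eqP[->].
Qed.

Section SpiderModule.
Local Open Scope ring_scope.
Variables (k : fieldType) (T : choiceType).

(** Among pairs with [p <= q], these are exactly the relations x_n < y_n. *)
Definition conflict (p q : spider T) : bool :=
  [&& p != q, p.2 != None & q.2 != None].

Definition spider_hom (p q : spider T) : 'Hom(k^o, k^o) :=
  if conflict p q then 0 else \1%VF.

Fact spider_hom_id (p : spider T) : (p <= p)%O -> spider_hom p p = \1%VF.
Proof. by rewrite /spider_hom /conflict eqxx. Qed.

Fact spider_hom_comp (p q r : spider T) :
    (p <= q)%O -> (q <= r)%O -> (p <= r)%O ->
  spider_hom p r = (spider_hom q r \o spider_hom p q)%VF.
Proof.
move=> /predU1P[<- qr _|pq /predU1P[<- _|qr]].
- by rewrite spider_hom_id ?comp_lfun1r // lexx.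
- by rewrite [spider_hom q q]spider_hom_id ?comp_lfun1l // lexx.
by case/and3P: pq qr => _ ->.
Qed.

Definition spider_module : pmodule k (spider T) :=
  @PModule k _ (spider T) (fun=> k^o) (fun p q _ => spider_hom p q)
    spider_hom_id spider_hom_comp.

End SpiderModule.

Section Counterexample.
Local Open Scope classical_set_scope.
Local Open Scope ring_scope.
Variable k : fieldType.

Definition tt_homo := spider_map_homo (fun _ : nat => tt).

Definition nat_module : pmodule k (spider nat) :=
  pullback tt_homo (spider_module k unit).

Lemma nat_module_tame : tame nat_module.
Proof. by exists _, (spider unit), _, tt_homo, (spider_module k unit). Qed.

(** Distinct comparable elements differ in their Boolean, so collapsing the indices keeps them
    distinct. *)
Lemma conflict_map (p q : spider nat) :
  (p <= q)%O ->
  conflict (spider_map (fun=> tt) p) (spider_map (fun=> tt) q) = conflict p q.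
Proof.
move=> /predU1P[->|]; first by rewrite /conflict !eqxx.
by case: p q => [[] [u|]] [[] [v|]].
Qed.

Lemma nat_module_map_id (p q : spider nat) (pq : (p <= q)%O) :
  ~~ conflict p q -> pmod_map nat_module pq = \1%VF.
Proof. by rewrite -conflict_map //= /spider_hom => /negPf ->. Qed.

Lemma nat_module_rank1 (I : Int (spider nat)) :
    (forall n, ~ (val I (false, Some n) /\ val I (true, Some n))) ->
  int_gri nat_module I = 1%N.
Proof.
move=> noconf; pose M := restr nat_module (val I).
pose phi p : {linear k^o -> M p} := [the {linear k^o -> k^o} of idfun].
pose psi p : {linear M p -> k^o} := [the {linear k^o -> k^o} of idfun].
apply: (grank_const (phi := phi) (psi := psi)) => // p q pq x.
rewrite -[LHS]/(pmod_map nat_module (val_homo pq) x).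
rewrite nat_module_map_id ?id_lfunE //.
(* A conflict inside [I] would be a relation x_u < y_u, excluded by [noconf]. *)
apply/and3P => -[+ p2 q2]; have := set_mem (valP p); have := set_mem (valP q).
case: (val p) (val q) p2 q2 (val_homo pq) => [a [u|]//] [b [v|]//] _ _ pq' Iq Ip.
move: pq' => /predU1P[->|/and3P[/= a0 b1 /eqP[uv]]]; first by rewrite eqxx.
by case: (noconf u); rewrite {2}uv; case: a b a0 b1 Ip Iq => [] [].
Qed.

Lemma nat_module_rank0 (I : Int (spider nat)) n :
    val I (false, Some n) -> val I (true, Some n) -> int_gri nat_module I = 0%N.
Proof.
move=> /mem_set Ix /mem_set Iy.
pose x : subposet (val I) := Sub (false, Some n) Ix.
pose y : subposet (val I) := Sub (true, Some n) Iy.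
(* [grank_eq0] uses the canonical map through the target of the zero map, so the base point is moved
   to [y]. *)
rewrite (int_gri_base _ y); apply: (@grank_eq0 _ _ _ _ x y) => [|xy].
  by apply/orP; right; rewrite /= eqxx.
by [].
Qed.

Definition core : set (spider nat) := [set p | p.2 = None].

Lemma core_Int (I : set (spider nat)) : core `<=` I -> I \in @Int _ (spider nat).
Proof.
move=> cI; apply/mem_set; split; first by exists (false, None); exact: cI.
  move=> p q r Ip Ir /predU1P[<- //|pq] /predU1P[-> //|qr].
  by case/and3P: pq qr => _ ->.
(* Each element is comparable to the core element with the opposite Boolean, and the two core
   elements b and c are comparable. *)
move=> p q Ip Iq; exists [:: (~~ p.1, None); (~~ q.1, None); q]; split => //=.
- have le_low_high u v : ((false, u) <= (true, v) :> spider nat)%O =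
    [|| u == None, v == None | u == v] by [].
  rewrite /Order.comparable.
  by case: p q {Ip Iq} => [[] u] [[] v]; rewrite /= ?lexx ?le_low_high ?eqxx ?orbT.
- move=> x; rewrite !inE => /or3P[] /eqP-> //; exact: cI.
Qed.

(** From each pair x_m, y_m this takes x_m when m = n and y_m otherwise; its only x is x_n, whence
    injectivity in [n]. *)
Definition selection n : set (spider nat) :=
  [set p | if p.2 is Some m then p.1 = (m != n) else True].

End Counterexample.

Theorem theorem2 (k : fieldType) :
  exists (disp : Order.disp_t) (P : porderType disp) (M : pmodule k P),
    tame M /\ ~ mobius_invertible (int_gri M).
Proof.
exists _, (spider nat), (nat_module k); split; first exact: nat_module_tame.
have coreP n : (core `<=` selection n)%classic.
  by move=> [a u]; rewrite /core /= => ->.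
pose J n : Int (spider nat) := Sub (selection n) (core_Int (coreP n)).
apply: (@mobius_not_invertible _ _ _ (Sub core (core_Int (@subset_refl _ core))) J).
- move=> m n [mn]; have : selection m (false, Some m) by rewrite /selection /= eqxx.
  by rewrite mn => /esym/negbFE/eqP.
- by move=> n; exact: coreP.
- move=> n; rewrite nat_module_rank1 // => m [xm ym].
  by have : false = true := etrans xm (esym ym).
- move=> n K JK rK; apply/val_inj/seteqP; split => // -[a [m|]] Ka //=.
  (* If [K] had an element outside the selection, its partner with the same index would be selected,
     so [K] would contain both x_m and y_m and have rank 0. *)
  apply: contra_neqP rK; rewrite -[selection _ _]/(a = (m != n)) => na.
  have Kb : val K (~~ a, Some m).
    apply: JK; rewrite -[val _ _]/(~~ a = (m != n)).
    by case: a (m != n) na {Ka} => [] [].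
  by apply: (@nat_module_rank0 k K m); case: a Ka Kb {na}.
Qed.
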